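(* Let $0<|q|<1$, fix a fourth root $q^{1/4}$ of $q$ (so $q^{m/4}:=(q^{1/4})^m$ for integers $m$), set $(-1)^{m/2}:=e^{\pi i m/2}$ for integers $m$, and let $u\in\mathbb{C}$ with $|u|<1$. Then \[ \sum_{i,j,k\geq 0}\frac{(-1)^{(i-2j+3k)/2}u^{i+k}q^{(i^{2}-i)/2+(i-2j+3k)^{2}/4}}{(q;q)_{i}(q^{2};q^{2})_{j}(q^{3};q^{3})_{k}} =\frac{(q;q^{2})_{\infty}(-u^{2};q^{3})_{\infty}}{(u^{2};q^{6})_{\infty}}. \]
   Context: For $a\in\mathbb{C}$ and $|p|<1$: $(a;p)_0=1$, $(a;p)_n=\prod_{k=0}^{n-1}(1-ap^k)$, $(a;p)_\infty=\prod_{k\ge0}(1-ap^k)$. *)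

(* Defs.v *)
From mathcomp Require Import all_boot all_order all_algebra.
From mathcomp Require Import finmap.
From mathcomp Require Import all_classical all_reals all_analysis.
From mathcomp Require Import complex.

Set Implicit Arguments.
Unset Strict Implicit.
Unset Printing Implicit Defensive.

Import Order.TTheory GRing.Theory Num.Theory.
Import numFieldNormedType.Exports.

Local Open Scope classical_set_scope.
Local Open Scope ring_scope.

Definition qpoch (K : numFieldType) (a p : K) (n : nat) : K :=
  \prod_(0 <= k < n) (1 - a * p ^+ k).

(* The limit exists for [`|p| < 1], the only range in which this is used. *)
Definition qpochinf (K : numFieldType) (a p : K) : K :=
  lim (qpoch a p n @[n --> \oo]).

(* Unordered summation: convergence along the net of finite subsets of [I].
   Over the complex numbers this is absolute convergence with sum [s]. *)
Definition has_sum (K : numFieldType) (I : choiceType) (f : I -> K) (s : K) :=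
  forall e : K, 0 < e ->
    exists A : {fset I}, forall B : {fset I}, (A `<=` B)%fset ->
      `|\sum_(x <- B) f x - s| < e.

Definition expi (R : realType) (t : R) : R[i] := Complex (cos t) (sin t).

(* (-1)^{m/2} := e^{pi i m/2} *)
Definition m1_half_pow (R : realType) (m : int) : R[i] :=
  expi (pi * m%:~R / 2).

(* The summand at (i, j, k). With [r] the chosen fourth root of [q], the power
   q^{(i^2-i)/2 + (i-2j+3k)^2/4} is r^{2(i^2-i) + (i-2j+3k)^2}. *)
Definition summand (R : realType) (q r u : R[i]) (x : nat * nat * nat) : R[i] :=
  let: (i, j, k) := x in
  let m : int := i%:Z - 2 * j%:Z + 3 * k%:Z in
  m1_half_pow R m * u ^+ (i + k)
    * r ^ (2 * (i%:Z ^+ 2 - i%:Z) + m ^+ 2)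
  / (qpoch q q i * qpoch (q ^+ 2) (q ^+ 2) j * qpoch (q ^+ 3) (q ^+ 3) k).

(* Main.v *)
Require Import Defs.
From mathcomp Require Import all_boot all_order all_algebra.
From mathcomp Require Import ring lra zify.
From mathcomp Require Import finmap.
From mathcomp Require Import all_classical all_reals all_analysis.
From mathcomp Require Import complex.

(* The sum over [j] is an Euler series: with [a = i + 3k] it equals
   [(-1)^(a/2) q^(a^2/4) (q^(1-a);q^2)_oo], which vanishes for odd [a] and is
   [(q;q^2)_oo (q;q^2)_b] for [a = 2b]. Putting [i + k = 2N], the claim becomes
   [sum_N g_N u^(2N) = (-u^2;q^3)_oo / (u^2;q^6)_oo], where [g_N] is a finite sum over
   [k <= 2N]. By creative telescoping [g] satisfies a second order recurrence, that is,
   [G(w) = sum_N g_N w^N] satisfies [(1 - w) G(w) = (1 + w) (1 + w q^3) G(w q^6)], and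
   iterating this equation gives the product. *)

Import Order.TTheory GRing.Theory Num.Theory.
Import numFieldNormedType.Exports.

Local Open Scope classical_set_scope.
Local Open Scope ring_scope.

Set Implicit Arguments.
Unset Strict Implicit.
Unset Printing Implicit Defensive.

(** * The finite sums [g_N] *)

(** The recurrence is read off the target: P(w) = (-w;q^3)_oo / (w;q^6)_oo satisfies (1 - w) P(w) =
    (1 + w) (1 + w q^3) P(w q^6), and comparing coefficients of w^n relates g_n, g_(n-1) and
    g_(n-2). Conversely, this equation together with G(0) = 1 and continuity at 0 determines G. Two
    analytic obstacles shape the rest. The argument q^(1-a) leaves the unit disc as a grows, so
    Euler's identity is needed at every complex argument. In the triple sum the power of q gives no
    decay in k where i - 2j + 3k stays bounded; only u^k does, so absolute convergence rests on |u|
    < 1. The functional equations are proved as exact identities between partial sums and then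
    passed to the limit. *)

Lemma qpochS (K : numFieldType) (a p : K) n :
  qpoch a p n.+1 = qpoch a p n * (1 - a * p ^+ n).
Proof. by rewrite /qpoch big_nat_recr. Qed.

Lemma qpoch0 (K : numFieldType) (a p : K) : qpoch a p 0 = 1.
Proof. by rewrite /qpoch big_nil. Qed.

Definition cubic_term (K : numFieldType) (q : K) (N k : nat) : K :=
  q ^+ 'C(N.*2 - k, 2) * qpoch q (q ^+ 2) (N + k)
  / (qpoch q q (N.*2 - k) * qpoch (q ^+ 3) (q ^+ 3) k).

Definition cubic_coef (K : numFieldType) (q : K) (N : nat) : K :=
  \sum_(0 <= k < N.*2.+1) cubic_term q N k.

Section CubicSum.
Variables (K : numFieldType) (q : K).
Hypotheses (q0 : q != 0) (q1 : forall n, q ^+ n.+1 != 1).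

Lemma qpoch_qq_neq0 n : qpoch q q n != 0.
Proof.
elim: n => [|n IH]; first by rewrite qpoch0 oner_eq0.
by rewrite qpochS mulf_neq0 // subr_eq0 eq_sym -exprS.
Qed.

Lemma qpoch_cube_neq0 n : qpoch (q ^+ 3) (q ^+ 3) n != 0.
Proof.
elim: n => [|n IH]; first by rewrite qpoch0 oner_eq0.
rewrite qpochS mulf_neq0 // subr_eq0 eq_sym -exprS -exprM mulnS.
exact: (q1 (2 + 3 * n)).
Qed.

(* The common factor of the [k]-th terms of the sums of index [M], [M.+1], [M.+2]. *)
Definition cubic_base (M k : nat) : K :=
  q ^+ 'C(M.*2.+4 - k, 2) * qpoch q (q ^+ 2) (M + k)
  / (qpoch q q (M.*2.+4 - k) * qpoch (q ^+ 3) (q ^+ 3) k).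

Let y M k := q ^+ (M.*2.+4 - k).

(** As 2(M + k) = 3k + (2M + 4 - k) - 4, the power q^M can be eliminated: all ratios to [cubic_base]
    become rational in q^k and [y M k]. *)
Lemma pow_split M k : (k <= M.*2.+4)%N ->
  q ^+ (2 * (M + k)) = q ^+ k ^+ 3 * y M k / q ^+ 4.
Proof.
move=> hk; rewrite /y -exprM -exprD; apply: (mulIf (expf_neq0 4 q0)).
rewrite mulfVK ?expf_neq0 // -exprD; congr (_ ^+ _); lia.
Qed.

Lemma cubic_term2 M k : (k <= M.*2.+4)%N ->
  cubic_term q M.+2 k = cubic_base M k
   * (1 - q ^+ k ^+ 3 * y M k / q ^+ 3) * (1 - q ^+ k ^+ 3 * y M k / q).
Proof.
move=> hk; rewrite /cubic_term /cubic_base !doubleS !addSn !qpochS.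
have -> : q * (q ^+ 2) ^+ (M + k) = q ^+ k ^+ 3 * y M k / q ^+ 3.
  by rewrite -exprM pow_split //; field.
have -> : q * (q ^+ 2) ^+ (M + k).+1 = q ^+ k ^+ 3 * y M k / q.
  by rewrite -exprM mulnS exprD pow_split //; field.
by ring.
Qed.

(** The factors (1 - y)(1 - y/q) vanish at k = 2M + 4 and k = 2M + 3, where the sum of index M + 1
    has no term, so one rational formula covers the common range. The four factors in [cubic_term0]
    do the same for index M. *)
Lemma cubic_term1 M k : (k <= M.*2.+4)%N ->
  (if (k <= M.*2.+2)%N then cubic_term q M.+1 k else 0) = cubic_base M k
   * (1 - q ^+ k ^+ 3 * y M k / q ^+ 3)
   * (q ^+ 3 / y M k ^+ 2 * (1 - y M k) * (1 - y M k / q)).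
Proof.
move=> hk; case: leqP => hk2; last first.
  have [->|->] : k = M.*2.+4 \/ k = M.*2.+3 by lia.
    by rewrite /y subnn; field.
  by rewrite /y subSnn; field.
rewrite /cubic_term /cubic_base !doubleS !addSn.
have -> : qpoch q (q ^+ 2) (M + k).+1
    = qpoch q (q ^+ 2) (M + k) * (1 - q ^+ k ^+ 3 * y M k / q ^+ 3).
  by rewrite qpochS -exprM pow_split //; field.
have hi : (M.*2.+4 - k = (M.*2.+2 - k).+2)%N by lia.
rewrite /y hi; set i := (M.*2.+2 - k)%N; rewrite !binS !bin1 !bin0.
have := qpoch_qq_neq0 i.+2; have := qpoch_cube_neq0 k.
rewrite !qpochS !exprD !exprS.
have : q ^+ i != 0 by rewrite expf_neq0.
move: (q ^+ i) (q ^+ k) (q ^+ 'C(i, 2)) (qpoch q q i) (qpoch _ _ k) (qpoch _ _ (M + k)).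
move=> z x b c d e z0 d0; rewrite !mulf_eq0 !negb_or => /andP[/andP[c0 c1] c2].
by field; rewrite ?z0 ?d0 ?c0 ?c1 ?c2 ?q0.
Qed.

Lemma cubic_term0 M k : (k <= M.*2.+4)%N ->
  (if (k <= M.*2)%N then cubic_term q M k else 0) = cubic_base M k
   * (q ^+ 10 / y M k ^+ 4 * (1 - y M k) * (1 - y M k / q)
      * (1 - y M k / q ^+ 2) * (1 - y M k / q ^+ 3)).
Proof.
move=> hk; case: leqP => hk2; last first.
  have [->|[->|[->|->]]] : k = M.*2.+4 \/ k = M.*2.+3 \/ k = M.*2.+2 \/ k = M.*2.+1.
    by lia.
  - by rewrite /y subnn; field.
  - by rewrite /y subSnn; field.
  - by rewrite /y (_ : _ - _ = 2)%N; [field | lia].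
  - by rewrite /y (_ : _ - _ = 3)%N; [field | lia].
rewrite /cubic_term /cubic_base.
have hi : (M.*2.+4 - k = (M.*2 - k).+4)%N by lia.
rewrite /y hi; set i := (M.*2 - k)%N; rewrite !binS !bin1 !bin0.
have := qpoch_qq_neq0 i.+4; have := qpoch_cube_neq0 k.
rewrite !qpochS !exprD !exprS.
have : q ^+ i != 0 by rewrite expf_neq0.
move: (q ^+ i) (q ^+ 'C(i, 2)) (qpoch q q i) (qpoch _ _ k) (qpoch _ _ (M + k)).
move=> z b c d e z0 d0.
rewrite !mulf_eq0 !negb_or => /andP[/andP[/andP[/andP[c0 c1] c2] c3] c4].
by field; rewrite ?z0 ?d0 ?c0 ?c1 ?c2 ?c3 ?c4 ?q0.
Qed.

Lemma cubic_baseS M k : (k < M.*2.+4)%N ->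
  (1 - (q * q ^+ k) ^+ 3) * cubic_base M k.+1 = cubic_base M k
   * (q / y M k * (1 - q ^+ k ^+ 3 * y M k / q ^+ 3) * (1 - y M k)).
Proof.
move=> hk; rewrite /cubic_base addnS.
have -> : qpoch q (q ^+ 2) (M + k).+1
    = qpoch q (q ^+ 2) (M + k) * (1 - q ^+ k ^+ 3 * y M k / q ^+ 3).
  by rewrite qpochS -exprM pow_split 1?ltnW //; field.
have hi : (M.*2.+4 - k = (M.*2.+3 - k).+1)%N by lia.
rewrite /y hi subSS; set i := (M.*2.+3 - k)%N; rewrite !binS !bin1.
have := qpoch_qq_neq0 i.+1; have := qpoch_cube_neq0 k.+1.
rewrite !qpochS !exprD (exprAC q 3 k).
have -> : q ^+ i.+1 = q * q ^+ i by rewrite exprS.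
have : q ^+ i != 0 by rewrite expf_neq0.
move: (q ^+ i) (q ^+ k) (q ^+ 'C(i, 2)) (qpoch q q i) (qpoch _ _ k) (qpoch _ _ (M + k)).
move=> z x b c d e z0; rewrite !mulf_eq0 !negb_or => /andP[d0 d1] /andP[c0 c1].
by field; rewrite z0 q0 c0 c1 d0 exprMn d1.
Qed.

(* The certificate, found by the q-Zeilberger algorithm, with [x = q^k] and
   [z = q^(2M+4-k)]; [q^M] only occurs through [q^(2M+4) = x z]. *)
Let cert (x z : K) : K :=
  -1 + q + x ^+ 3 * z ^+ 3 * (1 / q ^+ 5 + 1 / q) - q / z
  - x ^+ 3 * z ^+ 2 * (1 / q ^+ 5 + 1 / q ^+ 4 + 1 / q ^+ 3)
  + x ^+ 3 * z * (1 / q ^+ 4 + 2 / q ^+ 3) - x ^+ 6 * z ^+ 4 / q ^+ 4.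

(** The k-th term of the recurrence, moved to one side and divided by [cubic_base]; x^3 z^3 =
    q^(6M+12) carries the powers of q^3 in its coefficients. *)
Let summand_poly (x z : K) : K :=
  (1 - x ^+ 3 * z ^+ 3) * (1 - x ^+ 3 * z / q ^+ 3) * (1 - x ^+ 3 * z / q)
  - (1 + (1 + q ^+ 3) * (x ^+ 3 * z ^+ 3 / q ^+ 6)) * (1 - x ^+ 3 * z / q ^+ 3)
    * (q ^+ 3 / z ^+ 2 * (1 - z) * (1 - z / q))
  - x ^+ 3 * z ^+ 3 / q ^+ 9
    * (q ^+ 10 / z ^+ 4 * (1 - z) * (1 - z / q) * (1 - z / q ^+ 2) * (1 - z / q ^+ 3)).

(** The factor 1 - q^(3n) of the antidifference vanishes at n = 0, where the summation starts, and
    by [cubic_baseS] it absorbs the denominator that appears when [cubic_base] moves from n to n +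
    1. *)
Lemma cubic_telescope M n : (n <= M.*2.+4)%N ->
  \sum_(0 <= k < n) cubic_base M k * summand_poly (q ^+ k) (y M k)
  = (1 - q ^+ n ^+ 3) * cert (q ^+ n) (y M n) * cubic_base M n.
Proof.
elim: n => [|n IH] hn; first by rewrite big_nil expr0 expr1n subrr !mul0r.
rewrite big_nat_recr //= IH 1?ltnW //.
rewrite [RHS]mulrAC (exprS q n) cubic_baseS //.
have -> : y M n.+1 = y M n / q.
  apply: (mulIf q0); rewrite mulfVK // /y -exprSr; congr (_ ^+ _); lia.
have : y M n != 0 by rewrite expf_neq0.
rewrite /cert /summand_poly; move: (y M n) (q ^+ n) (cubic_base M n) => z x b z0.
by field; rewrite z0 q0.
Qed.

Lemma cubic_coef_rec M :
  (1 - q ^+ 3 ^+ (2 * M.+2)) * cubic_coef q M.+2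
  = (1 + (1 + q ^+ 3) * q ^+ 3 ^+ (2 * M.+1)) * cubic_coef q M.+1
    + q ^+ 3 ^+ (2 * M).+1 * cubic_coef q M.
Proof.
have ext N m (hm : (N.*2 <= m)%N) : cubic_coef q N
    = \sum_(0 <= k < m.+1) if (k <= N.*2)%N then cubic_term q N k else 0.
  by rewrite -big_mkcond /cubic_coef [LHS](@big_nat_widen _ _ _ _ _ m.+1).
have h0 : (M.*2 <= M.*2.+4)%N by lia.
have h1 : (M.+1.*2 <= M.*2.+4)%N by lia.
have h2 : (M.+2.*2 <= M.*2.+4)%N by lia.
rewrite (ext _ _ h0) (ext _ _ h1) (ext _ _ h2).
apply/eqP; rewrite -subr_eq0 opprD addrA !mulr_sumr -!sumrB; apply/eqP.
transitivity (\sum_(0 <= k < M.*2.+4.+1)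
    cubic_base M k * summand_poly (q ^+ k) (y M k)).
  apply: eq_big_nat => k /andP[_]; rewrite ltnS => hk.
  rewrite !doubleS hk cubic_term2 // cubic_term1 // cubic_term0 // /summand_poly.
  have e2 : q ^+ 3 ^+ (2 * M.+2) = q ^+ k ^+ 3 * y M k ^+ 3.
    rewrite /y -!exprM -exprD; congr (_ ^+ _); lia.
  have -> : q ^+ 3 ^+ (2 * M.+1) = q ^+ k ^+ 3 * y M k ^+ 3 / q ^+ 6.
    apply: (mulIf (expf_neq0 6 q0)); rewrite mulfVK ?expf_neq0 // -e2.
    rewrite -!exprM -exprD; congr (_ ^+ _); lia.
  have -> : q ^+ 3 ^+ (2 * M).+1 = q ^+ k ^+ 3 * y M k ^+ 3 / q ^+ 9.
    apply: (mulIf (expf_neq0 9 q0)); rewrite mulfVK ?expf_neq0 // -e2.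
    rewrite -!exprM -exprD; congr (_ ^+ _); lia.
  rewrite e2; move: (q ^+ k ^+ 3) (y M k) (cubic_base M k) => x z b.
  by ring.
(* The index k = 2M + 4 is split off because the exponent of [y] would be truncated beyond it. There
   y = 1, and its term cancels the telescoped value since [cert x 1] is -(1 - x^3/q)(1 -
   x^3/q^3). *)
rewrite big_nat_recr //= cubic_telescope // /y subnn /cert /summand_poly.
by field.
Qed.
End CubicSum.

(** * Bounds and limits *)

Lemma geometric_sum_le (K : numFieldType) (t : K) n : 0 <= t -> t < 1 ->
  \sum_(0 <= k < n) t ^+ k <= (1 - t)^-1.
Proof.
move=> t0 t1; have d0 : 0 < 1 - t by rewrite subr_gt0.
rewrite -(ler_pM2r d0) mulVf ?gt_eqF // mulrC big_mkord.
by rewrite -opprB mulNr -subrX1 opprB gerBl exprn_ge0.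
Qed.

Section QPochhammer.
Variable R : realType.
Local Notation C := R[i].

Lemma normC_real (z : C) : exists2 x : R, 0 <= x & `|z| = (x%:C)%C.
Proof.
have /complex_realP[x hx] : `|z| \is Num.real by exact: normr_real.
by exists x => //; rewrite -lecR -hx normr_ge0.
Qed.

Lemma posC_real (e : C) : 0 < e -> exists2 x : R, 0 < x & e = (x%:C)%C.
Proof.
move=> e0; have /complex_realP[x hx] := gtr0_real e0.
by exists x => //; rewrite -ltcR -hx.
Qed.

(** With t = a x^n <= a, 1/(1 - t) = 1 + t/(1 - t) <= exp(t/(1 - a)). Since the geometric sum is
    bounded, the product stays away from 0 uniformly in n. *)
Lemma qpoch_ge_expR (a x : R) n : 0 <= a -> a < 1 -> 0 <= x -> x < 1 ->
  expR (- (a / (1 - a) * \sum_(0 <= k < n) x ^+ k)) <= qpoch a x n.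
Proof.
move=> a0 a1 x0 x1; elim: n => [|n IH].
  by rewrite big_nil mulr0 oppr0 expR0 qpoch0.
rewrite big_nat_recr //= mulrDr opprD expRD qpochS.
apply: ler_pM; rewrite ?expR_ge0 //.
have xn0 : 0 <= x ^+ n by exact: exprn_ge0.
have xn1 : x ^+ n <= 1 by rewrite exprn_ile1 // ltW.
set t := a * x ^+ n.
have t0 : 0 <= t by rewrite mulr_ge0.
have ta : t <= a by rewrite ler_piMr.
have t1 : 0 < 1 - t by lra.
rewrite mulrAC -/t expRN -(invrK (1 - t)) lef_pV2 ?posrE ?expR_gt0 ?invr_gt0 //.
have -> : (1 - t)^-1 = 1 + t / (1 - t) by field; lra.
apply: le_trans (expR_ge1Dx _) _; rewrite ler_expR ler_wpM2l //.
by rewrite lef_pV2 ?posrE; lra.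
Qed.

Lemma qpoch_norm_lbound (a p : C) : `|a| < 1 -> `|p| < 1 ->
  exists2 c : C, 0 < c & forall n, c <= qpoch `|a| `|p| n.
Proof.
case: (normC_real a) => x x0 ->; case: (normC_real p) => y y0 ->.
rewrite -[1]/((1 : R)%:C)%C !ltcR => x1 y1.
exists (expR (- (x / (1 - x) * (1 - y)^-1)))%:C%C; first by rewrite ltcR expR_gt0.
move=> n; have -> : qpoch (x%:C)%C (y%:C)%C n = ((qpoch x y n)%:C)%C.
  by rewrite /qpoch rmorph_prod; apply: eq_bigr => k _; rewrite rmorphB rmorphM rmorphXn.
rewrite lecR; apply: le_trans (qpoch_ge_expR n x0 x1 y0 y1).
rewrite ler_expR lerN2 ler_wpM2l ?geometric_sum_le //.
by rewrite divr_ge0 // subr_ge0 ltW.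
Qed.

Lemma qpoch_norm_ge (a p : C) n : `|a| < 1 -> `|p| < 1 ->
  0 < qpoch `|a| `|p| n <= `|qpoch a p n|.
Proof.
move=> a1 p1; elim: n => [|n /andP[IH0 IH]]; first by rewrite !qpoch0 normr1 lexx ltr01.
have h : 0 < 1 - `|a| * `|p| ^+ n.
  rewrite subr_gt0; apply: le_lt_trans a1.
  by rewrite ler_piMr // exprn_ile1 // ltW.
rewrite !qpochS normrM mulr_gt0 //=; apply: ler_pM => //; [exact: ltW|exact: ltW|].
by apply: le_trans (lerB_dist _ _); rewrite normr1 normrM normrX.
Qed.

(** Factor by factor, (1 + t)(1 - t) <= 1. Hence the lower bound for (|a|;|p|)_n also yields an
    upper bound for |(a;p)_n|. *)
Lemma qpoch_norm_le (a p : C) n : `|a| < 1 -> `|p| < 1 ->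
  `|qpoch a p n| * qpoch `|a| `|p| n <= 1.
Proof.
move=> a1 p1; elim: n => [|n IH]; first by rewrite !qpoch0 normr1 mulr1.
rewrite !qpochS normrM mulrACA mulr_ile1 //.
- by rewrite mulr_ge0 // ltW //; case/andP: (qpoch_norm_ge n a1 p1).
- rewrite mulr_ge0 // subr_ge0 mulr_ile1 ?exprn_ge0 ?exprn_ile1 // ltW //.
apply: (@le_trans _ _ ((1 + `|a| * `|p| ^+ n) * (1 - `|a| * `|p| ^+ n))).
  rewrite ler_wpM2r //.
    by rewrite subr_ge0 mulr_ile1 ?exprn_ge0 ?exprn_ile1 // ltW.
  by apply: le_trans (ler_normB _ _) _; rewrite normr1 normrM normrX.
by rewrite mulrC -subr_sqr expr1n gerBl exprn_ge0 // mulr_ge0 // exprn_ge0.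
Qed.

Lemma qpoch_bounds (a p : C) : `|a| < 1 -> `|p| < 1 -> exists2 D : C, 0 < D &
  forall n, [/\ qpoch a p n != 0, `|(qpoch a p n)^-1| <= D & `|qpoch a p n| <= D].
Proof.
move=> a1 p1; have [c c0 hc] := qpoch_norm_lbound a1 p1.
exists c^-1; first by rewrite invr_gt0.
move=> n; have /andP[h0 h1] := qpoch_norm_ge n a1 p1.
have h2 : 0 < `|qpoch a p n| by exact: lt_le_trans h0 h1.
split; first by rewrite -normr_gt0.
  by rewrite normfV lef_pV2 ?posrE //; apply: le_trans h1.
rewrite -(ler_pM2r c0) mulVf ?gt_eqF //; apply: le_trans (qpoch_norm_le n a1 p1).
by rewrite ler_wpM2l.
Qed.

Lemma expr_neq1 (q : C) n : `|q| < 1 -> q ^+ n.+1 != 1.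
Proof.
move=> q1; apply/eqP => h; have : `|q ^+ n.+1| < 1 by rewrite normrX exprn_ilt1.
by rewrite h normr1 ltxx.
Qed.

End QPochhammer.

(* A record, so that unification does not see through the convergence of filters. *)
Record tends (K : numFieldType) (f : nat -> K) (l : K) : Prop :=
  Tends { tends_cvg : f n @[n --> \oo] --> l }.

Section Tends.
Variable K : numFieldType.
Implicit Types (f g : nat -> K) (l m : K).

Lemma tendsP f l : tends f l <->
  forall e, 0 < e -> exists N, forall n, (N <= n)%N -> `|l - f n| < e.
Proof.
split=> [[/cvgrPdist_lt h] e /h[N _ hN]|h]; first by exists N.
by split; apply/cvgrPdist_lt => e /h[N hN]; exists N.
Qed.

Lemma tends_lim f l : tends f l -> lim (f n @[n --> \oo]) = l.
Proof. by move=> [h]; apply: cvg_lim h; exact: norm_hausdorff. Qed.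

Lemma tends_uniq f l m : tends f l -> tends f m -> l = m.
Proof. by move=> /tends_lim <- /tends_lim. Qed.

Lemma tends_cst l : tends (fun=> l) l.
Proof. by split; exact: cvg_cst. Qed.

Lemma tendsD f g l m : tends f l -> tends g m -> tends (fun n => f n + g n) (l + m).
Proof. by move=> [hf] [hg]; split; exact: cvgD. Qed.

Lemma tendsB f g l m : tends f l -> tends g m -> tends (fun n => f n - g n) (l - m).
Proof. by move=> [hf] [hg]; split; exact: cvgB. Qed.

Lemma tendsM f g l m : tends f l -> tends g m -> tends (fun n => f n * g n) (l * m).
Proof. by move=> [hf] [hg]; split; exact: cvgM. Qed.

Lemma tendsMl f l m : tends f l -> tends (fun n => m * f n) (m * l).
Proof. by move=> h; apply: tendsM h; exact: tends_cst. Qed.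

Lemma tendsS f l : tends (fun n => f n.+1) l <-> tends f l.
Proof. by split=> -[h]; split; move: h; rewrite (cvg_shiftS f). Qed.

Lemma tends_shift k f l : tends (fun n => f (n + k)%N) l <-> tends f l.
Proof. by split=> -[h]; split; move: h; rewrite (cvg_shiftn k f). Qed.

Lemma tends_eq f g l : (forall n, f n = g n) -> tends f l -> tends g l.
Proof. by move=> /funext ->. Qed.

Lemma tends_sub (s : nat -> nat) f l : (forall n, (n <= s n)%N) ->
  tends f l -> tends (fun n => f (s n)) l.
Proof.
move=> hs /tendsP h; apply/tendsP => e /h[N hN].
by exists N => n hn; apply: hN; apply: leq_trans (hs n).
Qed.

Lemma tends_sum (I : Type) (r : seq I) (F : I -> nat -> K) (L : I -> K) :
  (forall i, tends (F i) (L i)) ->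
  tends (fun n => \sum_(i <- r) F i n) (\sum_(i <- r) L i).
Proof.
move=> h; elim: r => [|i r IH].
  by rewrite big_nil; apply: tends_eq (tends_cst 0) => n; rewrite big_nil.
rewrite big_cons; apply: tends_eq (tendsD (h i) IH) => n; by rewrite big_cons.
Qed.

Lemma tends_norm_bound f l B : tends f l -> (forall n, `|f n| <= B) -> `|l| <= B.
Proof.
move=> /tendsP fl fB.
have Br : B \is Num.real by apply: ger0_real; apply: le_trans (fB 0%N).
rewrite real_leNgt ?normr_real //; apply/negP => Bl.
have := fl (`|l| - B); rewrite subr_gt0 => /(_ Bl) [N hN].
have := hN N (leqnn N); rewrite ltrBrDr => h.
have : `|l| < `|l|; last by rewrite ltxx.
apply: le_lt_trans h; apply: le_trans (lerD (lexx _) (fB N)).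
by rewrite -{1}(subrK (f N) l) ler_normD.
Qed.

Lemma tends_quot f g l : (forall n, f n * g n = l) -> tends g 1 -> tends f l.
Proof.
move=> fg g1; have gV : tends (fun n => l * (g n)^-1) l.
  rewrite -[X in tends _ X]mulr1 -[X in _ * X]invr1; apply: tendsMl; split.
  by apply: cvgV (tends_cvg g1); rewrite oner_eq0.
(* [f n = l / g n] is available only where [g n] is nonzero, hence the shift by an N beyond which |1
   - g n| < 1. *)
have /tendsP/(_ 1 ltr01)[N hN] := g1.
apply: (tends_shift N f l).1; have := (tends_shift N _ l).2 gV.
apply: tends_eq => n.
rewrite -(fg (n + N)%N) mulfK //; apply/eqP => h.
by have := hN (n + N)%N (leq_addl _ _); rewrite h subr0 normr1 ltxx.
Qed.
End Tends.

(** * Convergence of complex power series *)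

Section ComplexSeries.
Variable R : realType.
Local Notation C := R[i].

Lemma tendsCP (f : nat -> C) (l : C) :
  (forall d : R, 0 < d ->
    exists N, forall n, (N <= n)%N -> `|l - f n| < d%:C%C) -> tends f l.
Proof. by move=> h; apply/tendsP => e /posC_real[d d0 ->]; exact: h. Qed.

Lemma tends_exprC (s : C) : `|s| < 1 -> tends (fun n => s ^+ n) 0.
Proof.
move=> s1; apply: tendsCP => d d0.
have [t t0 ht] := normC_real s.
have t1 : `|t| < 1 by rewrite ger0_norm // -ltcR -ht.
have /cvgrPdist_lt/(_ d d0)[N _ hN] := cvg_expr t1; exists N => n /hN /=.
rewrite !sub0r !normrN !normrX ht -rmorphXn /= ltcR.
by rewrite ger0_norm.
Qed.

(** Real and imaginary parts are dominated by a real geometric series, so each converges by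
    comparison over [R]. *)
Lemma cvg_pseries (c : nat -> C) (M x : C) : (forall n, `|c n| <= M) -> `|x| < 1 ->
  exists l, tends (fun n => \sum_(0 <= k < n) c k * x ^+ k) l.
Proof.
move=> cM x1; have [m m0 hm] : exists2 m : R, 0 <= m & forall n, `|c n| <= m%:C%C.
  have M0 : 0 <= M by exact: le_trans (cM 0%N).
  have := cM; rewrite -(ger0_norm M0); have [m m0 ->] := normC_real M.
  by exists m.
have [t t0 ht] := normC_real x.
have t1 : `|t| < 1 by rewrite ger0_norm // -ltcR -ht.
have cvgR (h : C -> R) : (forall z, `|h z|%:C%C <= `|z|) ->
    exists a, tends (fun n => \sum_(0 <= k < n) h (c k * x ^+ k)) a.
  move=> hh; suff /cvg_ex[a ha] : cvgn (series (fun k => h (c k * x ^+ k))) by exists a.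
  apply: (@normed_cvg _ R^o).
  apply: (@series_le_cvg R (fun k => `|h (c k * x ^+ k)|) (geometric m t)) => [n|n|n|].
  - exact: normr_ge0.
  - by rewrite /= mulr_ge0 // exprn_ge0.
  - rewrite -lecR; apply: le_trans (hh _) _.
    rewrite normrM normrX ht rmorphM rmorphXn ler_wpM2r //.
    by rewrite exprn_ge0 // lecR.
  - exact: is_cvg_geometric_series.
have hRe : forall z : C, `|complex.Re z|%:C%C <= `|z|.
  move=> [a b]; rewrite normc_def lecR /= -sqrtr_sqr ler_sqrt ?addr_ge0 ?sqr_ge0 //.
  by rewrite lerDl sqr_ge0.
have hIm : forall z : C, `|complex.Im z|%:C%C <= `|z|.
  move=> [a b]; rewrite normc_def lecR /= -sqrtr_sqr ler_sqrt ?addr_ge0 ?sqr_ge0 //.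
  by rewrite lerDr sqr_ge0.
have [a /tendsP ha] := cvgR _ hRe; have [b /tendsP hb] := cvgR _ hIm.
exists (Complex a b); apply: tendsCP => d d0.
have d20 : 0 < d / 2 by lra.
have [Na hNa] := ha _ d20; have [Nb hNb] := hb _ d20.
exists (maxn Na Nb) => n; rewrite geq_max => /andP[/hNa na /hNb nb].
have -> : \sum_(0 <= k < n) c k * x ^+ k = Complex
    (\sum_(0 <= k < n) complex.Re (c k * x ^+ k))
    (\sum_(0 <= k < n) complex.Im (c k * x ^+ k)).
  elim: (n) => [|j IH]; first by rewrite !big_nil.
  by rewrite !big_nat_recr //= IH; case: (c j * _).
move: na nb; move: (\sum_(_ <= _ < _) _) (\sum_(_ <= _ < _) _) => b' a' na nb.
have -> : Complex a b - Complex a' b' = (a - a')%:C%C + 'i%C * (b - b')%:C%C :> C.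
  by rewrite [LHS]complexE.
apply: le_lt_trans (ler_normD _ _) _.
rewrite normrM (_ : `|'i%C| = 1 :> C) ?mul1r; last first.
  by rewrite normc_def /= expr0n /= expr1n add0r sqrtr1.
have nrm (v : R) : `|v%:C%C| = (`|v|)%:C%C :> C.
  by rewrite normc_def /= expr0n /= addr0 sqrtr_sqr.
rewrite !nrm -rmorphD ltcR; lra.
Qed.
End ComplexSeries.

(** * Euler series and the series [G] *)

Lemma tends_squeeze (K : numFieldType) (f g : nat -> K) (l B : K) : 0 <= B ->
  (forall n, `|l - f n| <= B * `|g n|) -> tends g 0 -> tends f l.
Proof.
move=> B0 h /tendsP g0; apply/tendsP => e e0.
have B1 : 0 < B + 1 by rewrite ltr_wpDl.
have [N hN] := g0 (e / (B + 1)) (divr_gt0 e0 B1).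
exists N => n /hN; rewrite sub0r normrN ltr_pdivlMr // => hn.
apply: le_lt_trans (h n) _; apply: le_lt_trans hn.
by rewrite mulrC ler_wpM2l // lerDl.
Qed.

Lemma pseries_partial_le (K : numFieldType) (c : nat -> K) (M x : K) n :
  (forall k, `|c k| <= M) -> `|x| < 1 ->
  `|\sum_(0 <= k < n) c k * x ^+ k| <= M * (1 - `|x|)^-1.
Proof.
move=> cM x1; apply: le_trans (ler_norm_sum _ _ _) _.
have M0 : 0 <= M by exact: le_trans (cM 0%N).
apply: le_trans (ler_wpM2l M0 (geometric_sum_le n (normr_ge0 x) x1)).
by rewrite mulr_sumr; apply: ler_sum => k _; rewrite normrM normrX ler_wpM2r // exprn_ge0.
Qed.

Section Series.
Variable R : realType.
Local Notation C := R[i].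

(** Continuity of a power series at 0 along y = x s^n: P(y) - c_0 is y times a series bounded by M /
    (1 - |x|), uniformly in n because |y| <= |x|. It disposes of the last factor when a functional
    equation is iterated. *)
Lemma tends_pseries0 (c : nat -> C) (P : C -> C) (M x s : C) :
  (forall k, `|c k| <= M) -> `|x| < 1 -> `|s| < 1 ->
  (forall y, `|y| < 1 -> tends (fun n => \sum_(0 <= k < n) c k * y ^+ k) (P y)) ->
  tends (fun n => P (x * s ^+ n)) (c 0%N).
Proof.
move=> cM x1 s1 hP; have M0 : 0 <= M by exact: le_trans (cM 0%N).
have d0 : 0 < 1 - `|x| by rewrite subr_gt0.
apply: (@tends_squeeze _ _ (fun n => s ^+ n) _ (M * (1 - `|x|)^-1)).
- by rewrite mulr_ge0 // invr_ge0 ltW.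
- move=> n; set y := x * s ^+ n.
  have yx : `|y| <= `|x| by rewrite normrM normrX ler_piMr // exprn_ile1 // ltW.
  have y1 : `|y| < 1 by exact: le_lt_trans x1.
  have ys : `|y| <= `|s ^+ n| by rewrite normrM ler_piMl // ltW.
  rewrite distrC; apply: (@tends_norm_bound _
    (fun n => \sum_(0 <= k < n.+1) c k * y ^+ k - c 0%N)).
    apply: tendsB (tends_cst _); exact: (tendsS _ _).2 (hP y y1).
  move=> m; rewrite big_nat_recl //= expr0 mulr1 addrC addKr.
  under eq_bigr do rewrite exprS mulrCA.
  rewrite -mulr_sumr normrM mulrC; apply: ler_pM => //.
  apply: le_trans (pseries_partial_le m (fun k => cM k.+1) y1) _.
  rewrite ler_wpM2l // lef_pV2 ?posrE ?subr_gt0 //.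
  by rewrite lerD2l lerN2.
- exact: tends_exprC.
Qed.

Lemma qpochSl (K : numFieldType) (a p : K) n :
  qpoch a p n.+1 = (1 - a) * qpoch (a * p) p n.
Proof.
rewrite /qpoch big_nat_recl //= expr0 mulr1; congr (_ * _).
by apply: eq_bigr => k _; rewrite exprS mulrA.
Qed.

Lemma tends_qpoch_step (K : numFieldType) (a p l : K) :
  tends (qpoch (a * p) p) l -> tends (qpoch a p) ((1 - a) * l).
Proof.
move=> /(@tendsMl _ _ _ (1 - a)) h; apply: (tendsS _ _).1.
by apply: tends_eq h => n; rewrite qpochSl.
Qed.

Definition euler_coef (p : C) k : C := (-1) ^+ k * p ^+ 'C(k, 2) / qpoch p p k.

Lemma euler_coef_bound (p : C) : `|p| < 1 -> exists M, forall k, `|euler_coef p k| <= M.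
Proof.
move=> p1; have [D D0 hD] := qpoch_bounds p1 p1; exists D => k.
have [_ h _] := hD k; rewrite !normrM normrX normrN1 expr1n mul1r.
by rewrite -[D]mul1r ler_pM // normrX exprn_ile1 // ltW.
Qed.

(** Rests on e_(n+1) (1 - p^(n+1)) = -p^n e_n for e = [euler_coef p]. Being an identity of finite
    sums, it holds for |x| >= 1 too. *)
Lemma euler_partial_step (p x : C) n : `|p| < 1 ->
  \sum_(0 <= k < n.+1) euler_coef p k * x ^+ k
  = \sum_(0 <= k < n.+1) euler_coef p k * (x * p) ^+ k
    - x * \sum_(0 <= k < n) euler_coef p k * (x * p) ^+ k.
Proof.
move=> p1; elim: n => [|n IH].
  by rewrite !big_nat1 big_nil mulr0 subr0 !expr0.
rewrite big_nat_recr //= IH [in RHS]big_nat_recr //= [X in _ = _ - x * X]big_nat_recr //=.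
suff -> : euler_coef p n.+1 * x ^+ n.+1 = euler_coef p n.+1 * (x * p) ^+ n.+1
    - x * (euler_coef p n * (x * p) ^+ n) by ring.
have [D _ hD] := qpoch_bounds p1 p1; have [h1 _ _] := hD n.+1; have [h0 _ _] := hD n.
move: h1; rewrite /euler_coef qpochS mulf_eq0 negb_or => /andP[_].
rewrite !exprMn -(exprS p) !(exprS _ n) binS bin1 exprD => h1.
by field; rewrite h0 h1.
Qed.

(* For [|x| < 1], iterating [P x = (1 - x) P (x p)] gives [P x = (x;p)_n P (x p^n)], and
   [P (x p^n)] tends to [1]; this yields the existence of [(x;p)_oo] as well. *)
Lemma tends_euler_qpoch (p x : C) : `|p| < 1 -> exists2 l,
  tends (fun n => \sum_(0 <= k < n) euler_coef p k * x ^+ k) l & tends (qpoch x p) l.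
Proof.
move=> p1; have [M hM] := euler_coef_bound p1.
have small y : `|y| < 1 -> exists2 l,
    tends (fun n => \sum_(0 <= k < n) euler_coef p k * y ^+ k) l & tends (qpoch y p) l.
  move=> y1; have /choice[P hP] : forall z : C, exists l, `|z| < 1 ->
      tends (fun n => \sum_(0 <= k < n) euler_coef p k * z ^+ k) l.
    move=> z; have [z1|_] := boolP (`|z| < 1); last by exists 0.
    by have [l hl] := cvg_pseries hM z1; exists l.
  have zp z n : `|z| < 1 -> `|z * p ^+ n| < 1.
    move=> z1; apply: le_lt_trans z1; rewrite normrM normrX.
    by rewrite ler_piMr // exprn_ile1 // ltW.
  have Pstep z : `|z| < 1 -> P z = (1 - z) * P (z * p).
    move=> z1; have zp1 : `|z * p| < 1 by rewrite -[p]expr1 zp.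
    apply: tends_uniq ((tendsS _ _).2 (hP z z1)) _.
    rewrite mulrBl mul1r; apply: tends_eq (tendsB ((tendsS _ _).2 (hP _ zp1))
      (@tendsMl _ _ _ z (hP _ zp1))) => n.
    by rewrite -(euler_partial_step z n p1).
  exists (P y); first exact: hP.
  have e1 : euler_coef p 0 = 1 by rewrite /euler_coef qpoch0 !expr0 !mul1r invr1.
  apply: (@tends_quot _ _ (fun n => P (y * p ^+ n))).
    elim=> [|n IH]; first by rewrite qpoch0 mul1r expr0 mulr1.
    by rewrite -IH qpochS (Pstep (y * p ^+ n)) ?zp // exprSr !mulrA.
  by rewrite -e1; apply: (tends_pseries0 hM).
(* For any other x some x p^m lies in the disc; going back m steps carries both limits to x, each
   step by the same functional equation. *)
have [m hm] : exists m, `|x * p ^+ m| < 1.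
  have /tendsP/(_ _ (@ltr01 C))[N hN] := @tendsMl _ _ _ x (tends_exprC p1).
  by exists N; have := hN N (leqnn N); rewrite mulr0 sub0r normrN.
elim: m x hm => [|m IH] x; first by rewrite expr0 mulr1; exact: small.
rewrite exprS mulrA => /IH [l h1 h2]; exists ((1 - x) * l).
  apply: (tendsS _ _).1; rewrite mulrBl mul1r.
  apply: tends_eq (tendsB ((tendsS _ _).2 h1) (@tendsMl _ _ _ x h1)) => n.
  by rewrite -(euler_partial_step x n p1).
exact: tends_qpoch_step.
Qed.

Lemma tends_qpochinf (p x : C) : `|p| < 1 -> tends (qpoch x p) (qpochinf x p).
Proof.
by move=> p1; have [l _ h] := tends_euler_qpoch x p1; rewrite /qpochinf (tends_lim h).
Qed.

Lemma tends_euler (p x : C) : `|p| < 1 ->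
  tends (fun n => \sum_(0 <= k < n) euler_coef p k * x ^+ k) (qpochinf x p).
Proof.
by move=> p1; have [l h1 h] := tends_euler_qpoch x p1; rewrite /qpochinf (tends_lim h).
Qed.

Lemma qpochinfSl (p x : C) : `|p| < 1 -> qpochinf x p = (1 - x) * qpochinf (x * p) p.
Proof.
move=> p1; apply: tends_uniq (tends_qpochinf x p1) _.
exact/tends_qpoch_step/tends_qpochinf.
Qed.

(** The finite products stay at distance at least 1/D from 0, hence so does their limit. *)
Lemma qpochinf_neq0 (p x : C) : `|p| < 1 -> `|x| < 1 -> qpochinf x p != 0.
Proof.
move=> p1 x1; have [D D0 hD] := qpoch_bounds x1 p1; apply/eqP => h0.
have /tendsP/(_ D^-1) := tends_qpochinf x p1; rewrite invr_gt0 => /(_ D0) [N hN].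
have := hN N (leqnn N); have [h1 h2 _] := hD N.
rewrite h0 sub0r normrN -[X in X < _]invrK -normfV ltf_pV2 ?posrE ?normr_gt0 ?invr_eq0 //.
by move=> /(le_lt_trans h2); rewrite ltxx.
Qed.

(** * The generating function of the finite sums *)

Lemma cubic_coef_bound (q : C) : 0 < `|q| -> `|q| < 1 ->
  exists M, forall N, `|cubic_coef q N| <= M.
Proof.
move=> q0 q1; have q21 : `|q ^+ 2| < 1 by rewrite normrX exprn_ilt1.
have q31 : `|q ^+ 3| < 1 by rewrite normrX exprn_ilt1.
have [D1 D10 h1] := qpoch_bounds q1 q1; have [D2 D20 h2] := qpoch_bounds q1 q21.
have [D3 D30 h3] := qpoch_bounds q31 q31.
exists (D2 * (D1 * D3) * (`|q|^-1 * (1 - `|q|)^-1)) => N; rewrite /cubic_coef.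
apply: le_trans (ler_norm_sum _ _ _) _.
apply: (@le_trans _ _ (\sum_(0 <= k < N.*2.+1)
    D2 * (D1 * D3) * (`|q|^-1 * `|q| ^+ (N.*2 - k)))).
  apply: ler_sum => k _; rewrite /cubic_term !normrM invfM !normrM.
  have [_ a1 _] := h1 (N.*2 - k)%N; have [_ _ a2] := h2 (N + k)%N.
  have [_ a3 _] := h3 k.
  rewrite mulrC [X in _ * X]mulrC mulrA; apply: ler_pM.
  - by rewrite !mulr_ge0.
  - by [].
  - by rewrite [X in _ <= X]mulrC; do 2?apply: ler_pM => //; rewrite ?mulr_ge0.
  (* With i = 2N - k, i <= C(i,2) + 1 gives |q|^C(i,2) <= |q|^-1 |q|^i, a geometric bound whose sum
     is uniform in N. *)
  rewrite normrX -(ler_pM2l q0) mulrA mulfV ?gt_eqF // mul1r -exprS.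
  move: (N.*2 - k)%N => i; apply: ler_wiXn2l; rewrite ?normr_ge0 ?ltW //.
  by case: i => [|[|i]] //; rewrite ltnS binS bin1 leq_addl.
rewrite -mulr_sumr ler_wpM2l ?mulr_ge0 ?(ltW D10) ?(ltW D20) ?(ltW D30) //.
rewrite -mulr_sumr ler_wpM2l ?invr_ge0 //.
rewrite big_nat_rev /= add0n; under eq_big_nat => k hk.
  rewrite (_ : N.*2 - (N.*2.+1 - k.+1) = k)%N; last by lia.
  over.
exact: geometric_sum_le.
Qed.

Lemma tends_cubic_series (q w : C) : 0 < `|q| -> `|q| < 1 -> `|w| < 1 ->
  tends (fun n => \sum_(0 <= k < n) cubic_coef q k * w ^+ k)
    (qpochinf (- w) (q ^+ 3) / qpochinf w (q ^+ 6)).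
Proof.
move=> q0 q1 w1; have [M hM] := cubic_coef_bound q0 q1.
have q00 : q != 0 by rewrite -normr_gt0.
have qn1 n : q ^+ n.+1 != 1 by exact: expr_neq1.
have q31 : `|q ^+ 3| < 1 by rewrite normrX exprn_ilt1.
have q61 : `|q ^+ 6| < 1 by rewrite normrX exprn_ilt1.
have /choice[G hG] : forall z : C, exists l, `|z| < 1 ->
    tends (fun n => \sum_(0 <= k < n) cubic_coef q k * z ^+ k) l.
  move=> z; have [z1|_] := boolP (`|z| < 1); last by exists 0.
  by have [l hl] := cvg_pseries hM z1; exists l.
have zp z n : `|z| < 1 -> `|z * q ^+ 6 ^+ n| < 1.
  move=> z1; apply: le_lt_trans z1; rewrite normrM normrX.
  by rewrite ler_piMr // exprn_ile1 // ltW.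
(* The recurrence starts at index 2; g_0 and g_1 settle the coefficients of z^0 and z^1 in the
   functional equation. *)
have c0 : cubic_coef q 0 = 1.
  by rewrite /cubic_coef big_nat1 /cubic_term /= !qpoch0 expr0 mulr1 invr1 mulr1.
have c1 : (1 - q ^+ 6) * cubic_coef q 1 = 1 + (1 + q ^+ 3).
  rewrite /cubic_coef !big_nat_recr //= big_nil /cubic_term /= !qpochS !qpoch0.
  have := qn1 0%N; have := qn1 1%N; have := qn1 2%N; have := qn1 5%N.
  rewrite -![_ == 1]subr_eq0 -![(_ - 1) == 0]oppr_eq0 !opprB => a1 a2 a3 a4.
  rewrite (_ : 'C(1.*2 - 0, 2) = 1)%N // (_ : 'C(1.*2 - 1, 2) = 0)%N //.
  rewrite (_ : 'C(1.*2 - 1.*2, 2) = 0)%N // -[1.*2]/2%N.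
  by field; rewrite -expr2 -exprM a1 a2 a3 a4.
have Gstep z : `|z| < 1 ->
    (1 - z) * G z = (1 + z) * (1 + z * q ^+ 3) * G (z * q ^+ 6).
  move=> z1; have zp1 : `|z * q ^+ 6| < 1 by rewrite -[q ^+ 6]expr1 zp.
  set s := fun z n => \sum_(0 <= k < n) cubic_coef q k * z ^+ k.
  (* The truncations are staggered so that every product stops at the same degree in z; the
     functional equation is then exact for each n. *)
  have e n : s z n.+2 - z * s z n.+1 = s (z * q ^+ 6) n.+2
      + ((1 + q ^+ 3) * z) * s (z * q ^+ 6) n.+1 + (q ^+ 3 * z ^+ 2) * s (z * q ^+ 6) n.
    elim: n => [|n IH].
      rewrite /s !big_nat_recr //= !big_nil !expr0 !expr1 c0.
      have E : cubic_coef q 1 = q ^+ 6 * cubic_coef q 1 + (1 + (1 + q ^+ 3)).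
        by rewrite -c1; ring.
      by rewrite [in LHS]E; ring.
    have sS y m : s y m.+1 = s y m + cubic_coef q m * y ^+ m.
      by rewrite /s big_nat_recr.
    have -> : s z n.+3 - z * s z n.+2 = (s z n.+2 - z * s z n.+1)
        + (cubic_coef q n.+2 * z ^+ n.+2 - z * (cubic_coef q n.+1 * z ^+ n.+1)).
      by rewrite (sS z n.+2) {2}(sS z n.+1); ring.
    have := cubic_coef_rec q00 qn1 n.
    have -> : q ^+ 3 ^+ (2 * n.+2) = q ^+ 6 ^+ n * q ^+ 12.
      by rewrite -!exprM -exprD; congr (_ ^+ _); clear; lia.
    have -> : q ^+ 3 ^+ (2 * n.+1) = q ^+ 6 ^+ n * q ^+ 6.
      by rewrite -!exprM -exprD; congr (_ ^+ _); clear; lia.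
    have -> : q ^+ 3 ^+ (2 * n).+1 = q ^+ 6 ^+ n * q ^+ 3.
      by rewrite -!exprM -exprD; congr (_ ^+ _); clear; lia.
    rewrite IH (sS _ n.+2) (sS _ n.+1) (sS _ n) !(exprMn _ z) !(exprS (q ^+ 6)) !(exprS z).
    move: (cubic_coef _ _) (cubic_coef _ _) (cubic_coef _ _) => g0 g1 g2.
    rewrite mulrBl mul1r => /(canRL (subrK _)) E.
    rewrite [in LHS]E; ring.
  apply: tends_uniq.
    rewrite mulrBl mul1r; apply: tendsB (@tendsMl _ _ _ z ((tendsS _ _).2 (hG _ z1))).
    exact: ((tendsS (fun n => s z n.+1) _).2 ((tendsS _ _).2 (hG _ z1))).
  rewrite (_ : _ * _ * G _ = G (z * q ^+ 6) + ((1 + q ^+ 3) * z) * G (z * q ^+ 6)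
      + (q ^+ 3 * z ^+ 2) * G (z * q ^+ 6)); last by ring.
  have h := hG _ zp1; have h1 := (tendsS _ _).2 h.
  have h2 : tends (fun n => s (z * q ^+ 6) n.+2) (G (z * q ^+ 6)).
    exact: (tendsS (fun n => s (z * q ^+ 6) n.+1) _).2 h1.
  by apply: tends_eq (tendsD (tendsD h2 (tendsMl _ h1)) (tendsMl _ h)) => n; rewrite -e.
(* For z = w q^(6n), 1 + z and 1 + z q^3 are the factors of index 2n and 2n + 1 of (-w;q^3)_oo,
   hence the doubled length. *)
have iter n : qpoch w (q ^+ 6) n * G w
    = qpoch (- w) (q ^+ 3) n.*2 * G (w * q ^+ 6 ^+ n).
  elim: n => [|n IH]; first by rewrite !qpoch0 expr0 mulr1.
  have h := Gstep _ (zp _ n w1).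
  rewrite doubleS !qpochS [LHS]mulrAC IH (exprSr (q ^+ 6) n).
  rewrite (mulrA w).
  transitivity (qpoch (- w) (q ^+ 3) n.*2 * ((1 - w * q ^+ 6 ^+ n) * G (w * q ^+ 6 ^+ n))).
    by ring.
  rewrite h -!exprM (_ : 3 * n.*2 = 6 * n)%N; last by clear; lia.
  rewrite (_ : 3 * n.*2.+1 = 6 * n + 3)%N; last by clear; lia.
  by rewrite exprD; ring.
suff <- : G w = qpochinf (- w) (q ^+ 3) / qpochinf w (q ^+ 6) by exact: hG.
apply: (mulIf (qpochinf_neq0 q61 w1)); rewrite mulfVK ?qpochinf_neq0 //.
rewrite mulrC; apply: tends_uniq.
  rewrite mulrC; exact: tendsMl (tends_qpochinf w q61).
rewrite -[qpochinf (- w) _]mulr1 -c0.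
have hd n : (n <= n.*2)%N by rewrite -addnn leq_addr.
have h1 := tends_sub (s := double) hd (tends_qpochinf (- w) q31).
apply: tends_eq (tendsM h1 (tends_pseries0 hM w1 q61 hG)) => n.
by rewrite -iter mulrC.
Qed.
End Series.

(** * Unordered summation *)

Lemma big_fset_split (V : nmodType) (I : choiceType) (F : I -> V) (A B : {fset I}) :
  (A `<=` B)%fset ->
  \sum_(x <- B) F x = \sum_(x <- A) F x + \sum_(x <- (B `\` A)%fset) F x.
Proof.
move=> /fsubsetP AB; rewrite -big_cat; apply: perm_big; apply: uniq_perm.
- exact: fset_uniq.
- rewrite cat_uniq !fset_uniq /= andbT; apply/hasPn => x.
  by rewrite in_fsetD => /andP[].
- move=> x; rewrite mem_cat in_fsetD.
  by have [/AB|] := boolP (x \in A).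
Qed.

Lemma ler_sum_fset_seq (K : numDomainType) (I : choiceType) (F : I -> K)
    (B : {fset I}) (s : seq I) : (forall x, 0 <= F x) -> uniq s -> {subset B <= s} ->
  \sum_(x <- B) F x <= \sum_(x <- s) F x.
Proof.
move=> F0 us Bs.
have -> : \sum_(x <- B) F x = \sum_(x <- s | x \in B) F x.
  rewrite -[RHS]big_filter; apply: perm_big; apply: uniq_perm.
  - exact: fset_uniq.
  - exact: filter_uniq.
  - by move=> x; rewrite mem_filter; have [/Bs ->|] := boolP (x \in B).
by rewrite big_mkcond; apply: ler_sum => x _; case: ifP.
Qed.

Section HasSum.
Variable R : realType.
Local Notation C := R[i].

(** Choose A0 whose norm sum is within d/2 of the supremum, then B0 above A0 whose sum is within d/2
    of [s]: all terms outside B0 together add at most d/2 in norm. Exhibiting one good superset of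
    each finite set thus suffices. *)
Lemma has_sum_approx (I : choiceType) (f : I -> C) (s M : C) :
  (forall B : {fset I}, \sum_(x <- B) `|f x| <= M) ->
  (forall (A : {fset I}) e, 0 < e ->
    exists2 B : {fset I}, (A `<=` B)%fset & `|\sum_(x <- B) f x - s| < e) ->
  has_sum f s.
Proof.
move=> fM happ e e0.
have /choice[nf hnf] : forall x, exists v : R, 0 <= v /\ `|f x| = v%:C%C.
  by move=> x; have [v v0 hv] := normC_real (f x); exists v.
have nsum (s' : seq I) : \sum_(x <- s') `|f x| = (\sum_(x <- s') nf x)%:C%C.
  by rewrite rmorph_sum; apply: eq_bigr => x _; case: (hnf x).
have [d d0 ed] := posC_real e0; have d20 : 0 < d / 2 by lra.
pose S := [set y | exists B : {fset I}, y = \sum_(x <- B) nf x]%classic.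
have Ssup : has_sup S.
  split; first by exists (\sum_(x <- (fset0 : {fset I})) nf x); exists fset0.
  have M0 : 0 <= M by apply: le_trans (fM fset0); rewrite big_seq_fset0.
  exists (complex.Re M) => _ [B ->]; move: (fM B); rewrite nsum.
  by rewrite lecE => /andP[].
have [_ [A0 ->] hA0] := sup_adherent d20 Ssup.
have d2C : 0 < (d / 2)%:C%C :> C by rewrite ltcR.
have [B0 AB0 hB0] := happ A0 _ d2C.
exists B0 => B BB0; rewrite (big_fset_split _ BB0) addrAC.
apply: le_lt_trans (ler_normD _ _) _.
rewrite ed [d in (d%:C)%C](_ : d = d / 2 + d / 2); last by lra.
rewrite rmorphD; apply: ltr_leD => //; apply: le_trans (ler_norm_sum _ _ _) _.
rewrite nsum lecR.
have hB : \sum_(x <- B) nf x <= sup S by apply: sup_upper_bound => //; exists B.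
have hAB : \sum_(x <- A0) nf x <= \sum_(x <- B0) nf x.
  apply: ler_sum_fset_seq; [by move=> x; case: (hnf x)|exact: fset_uniq|exact/fsubsetP].
move: hB; rewrite (big_fset_split _ BB0); lra.
Qed.

(** Under truncated subtraction the exponent is |b - j|, so one geometric series on each side of b
    suffices, and the bound is independent of b. *)
Lemma sum_dist_geometric (t : C) b n : 0 <= t -> t < 1 ->
  \sum_(0 <= j < n) t ^+ ((b - j) + (j - b)) <= 2 * (1 - t)^-1.
Proof.
move=> t0 t1; apply: (@le_trans _ _ (\sum_(0 <= j < b.+1) t ^+ j + \sum_(0 <= j < n) t ^+ j)).
  elim: b n => [|b IH] n.
    rewrite big_nat1 expr0; under eq_bigr do rewrite sub0n subn0 add0n.
    by rewrite lerDr.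
  case: n => [|n]; first by rewrite !big_nil addr0 sumr_ge0 // => j _; rewrite exprn_ge0.
  rewrite big_nat_recl //= subn0 sub0n addn0 [X in _ <= X + _]big_nat_recr //=.
  rewrite [X in _ <= X + _]addrC -addrA lerD2l.
  under eq_bigr do rewrite !subSS.
  apply: le_trans (IH n) _; rewrite lerD2l big_nat_recr //= lerDl exprn_ge0 //.
by rewrite mulr_natl mulr2n lerD // geometric_sum_le.
Qed.

Lemma m1_half_pow0 : m1_half_pow R 0 = 1.
Proof. by rewrite /m1_half_pow /expi mulr0 mul0r cos0 sin0. Qed.

Lemma m1_half_powD2 m : m1_half_pow R (m + 2) = - m1_half_pow R m.
Proof.
rewrite /m1_half_pow /expi.
rewrite (_ : pi * (m + 2)%:~R / 2 = pi * m%:~R / 2 + pi); last by rewrite intrD; field.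
by rewrite cosDpi sinDpi.
Qed.

Lemma m1_half_powB m (j : nat) :
  m1_half_pow R (m - 2 * j%:Z) = (-1) ^+ j * m1_half_pow R m.
Proof.
elim: j => [|j IH]; first by rewrite mulr0 subr0 mul1r.
apply: oppr_inj; rewrite -m1_half_powD2 exprS mulN1r mulNr opprK -IH.
by congr m1_half_pow; lia.
Qed.

Lemma norm_m1_half_pow m : `|m1_half_pow R m| = 1.
Proof.
by rewrite normc_def /m1_half_pow /expi /= cos2Dsin2 sqrtr1.
Qed.
End HasSum.

Lemma bin2_sq j : ('C(j, 2).*2 + j = j * j)%N.
Proof. elim: j => // j IH; rewrite binS bin1; lia. Qed.

Lemma half_dist_le (i j k : nat) :
  ((i + 3 * k)./2 - j + (j - (i + 3 * k)./2) <= `|(i%:Z - 2 * j%:Z + 3 * k%:Z)%R|)%N.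
Proof. lia. Qed.

(** Enumerated by s = i + k, then k, then j, so that the innermost sum is a partial Euler series and
    the outer sums run over antidiagonals. *)
Definition triangle n J : seq (nat * nat * nat) :=
  [seq (p.1, j, p.2) | p <- [seq ((s - k)%N, k) | s <- index_iota 0 n,
    k <- index_iota 0 s.+1], j <- index_iota 0 J].

Lemma mem_triangle n J i j k : ((i, j, k) \in triangle n J) = (i + k < n)%N && (j < J)%N.
Proof.
apply/allpairsPdep/andP => [[[a b] [c []]]|[hn hJ]].
  move=> /allpairsPdep[s [k' []]]; rewrite !mem_index_iota => /= hs hk [-> ->] hc [-> -> ->].
  by split; lia.
exists (i, k), j; rewrite mem_index_iota; split => //.
apply/allpairsPdep; exists (i + k)%N, k; rewrite !mem_index_iota addnK; split => //; lia.
Qed.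

Lemma uniq_triangle n J : uniq (triangle n J).
Proof.
apply: allpairs_uniq_dep => [||[x c] [y d] _ _ /= [h1 h2 h3]].
- apply: allpairs_uniq_dep => [|s _|[s k] [s' k']]; rewrite ?iota_uniq //.
  move=> /allpairsPdep[? [? [_]]] + [-> ->] /allpairsPdep[? [? [_]]] + [-> ->] /=.
  rewrite !mem_index_iota => h1 h2 [h3 h4]; congr existT; lia.
- by move=> x _; rewrite iota_uniq.
- by rewrite [x]surjective_pairing [y]surjective_pairing h1 h2 h3.
Qed.

(** * The triple sum: domination and evaluation *)

Section Assembly.
Variables (R : realType) (q r u : R[i]).
Hypotheses (q0 : 0 < `|q|) (q1 : `|q| < 1) (rq : r ^+ 4 = q) (u1 : `|u| < 1).
Local Notation C := R[i].

Let qN0 : q != 0. Proof. by rewrite -normr_gt0. Qed.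
Let rN0 : r != 0. Proof. by apply/eqP => r0; move: qN0; rewrite -rq r0 expr0n eqxx. Qed.
Let r1 : `|r| < 1.
Proof. by rewrite -(@expr_lt1 _ 4) // -normrX rq. Qed.
Let r0 : 0 < `|r|. Proof. by rewrite normr_gt0. Qed.
Let q21 : `|q ^+ 2| < 1. Proof. by rewrite normrX exprn_ilt1. Qed.
Let q31 : `|q ^+ 3| < 1. Proof. by rewrite normrX exprn_ilt1. Qed.

(** Geometric decay has three sources: i^2 - i for i, u^k for k, and m^2 for the distance of j from
    (i + 3k)/2. The factor |r|^-1 pays for i <= 2(i^2 - i) + 1. *)
Lemma summand_bound : exists M : C, forall i j k,
  `|summand q r u (i, j, k)|
  <= M * (`|r| ^+ i * (`|u| ^+ k
     * `|r| ^+ (((i + 3 * k)./2 - j) + (j - (i + 3 * k)./2)))).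
Proof.
have [D1 D10 h1] := qpoch_bounds q1 q1; have [D2 D20 h2] := qpoch_bounds q21 q21.
have [D3 D30 h3] := qpoch_bounds q31 q31.
exists (D1 * D2 * D3 * `|r|^-1) => i j k; rewrite /summand.
set m := (_ + _ : int).
have -> : 2 * (i%:Z ^+ 2 - i%:Z) + m ^+ 2 = (2 * (i * i - i) + `|m|%N * `|m|%N)%N :> int.
  have hi : (i <= i * i)%N by case: i {m} => // v; rewrite leq_pmulr.
  by rewrite PoszD !PoszM -subzn // PoszM abszE -!expr2 real_normK ?num_real.
rewrite normrM normfV !normrM norm_m1_half_pow mul1r !normrX.
have [_ a1 _] := h1 i; have [_ a2 _] := h2 j; have [_ a3 _] := h3 k.
have hD : `|qpoch q q i * qpoch (q ^+ 2) (q ^+ 2) j * qpoch (q ^+ 3) (q ^+ 3) k|^-1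
    <= D1 * D2 * D3.
  by rewrite !normrM !invfM -!normfV; do 2?apply: ler_pM => //; rewrite mulr_ge0.
have hE : `|r| ^+ (2 * (i * i - i) + `|m| * `|m|)
    <= `|r|^-1 * (`|r| ^+ i * `|r| ^+ (((i + 3 * k)./2 - j) + (j - (i + 3 * k)./2))).
  rewrite -(ler_pM2l r0) mulVKf ?gt_eqF // -exprS -exprD.
  apply: ler_wiXn2l; rewrite ?normr_ge0 ?ltW //.
  have hm : (((i + 3 * k)./2 - j) + (j - (i + 3 * k)./2) <= `|m|)%N by exact: half_dist_le.
  have hm2 : (`|m| <= `|m| * `|m|)%N by case: `|m|%N => // v; rewrite leq_pmulr.
  have hi : (i <= (2 * (i * i - i)).+1)%N.
    case: (i) => // v; rewrite (mulSn v) addKn ltnS.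
    by rewrite (leq_trans (leq_pmulr v (ltn0Sn v))) // leq_pmull.
  by rewrite -addSn leq_add // (leq_trans hm).
have hu : `|u| ^+ (i + k) <= `|u| ^+ k.
  by apply: ler_wiXn2l; rewrite ?normr_ge0 ?leq_addl // ltW.
have h4 : 0 <= `|u| ^+ (i + k) by rewrite exprn_ge0.
have h5 : 0 <= `|r| ^+ (2 * (i * i - i) + `|m| * `|m|) by rewrite exprn_ge0.
have hX := ler_pM h4 h5 hu hE.
rewrite -!normrM; apply: le_trans (ler_pM (mulr_ge0 h4 h5) _ hX hD) _.
  by rewrite invr_ge0.
rewrite le_eqVlt; apply/orP; left; apply/eqP; ring.
Qed.

Lemma norm_sums_bounded : exists M : C, forall B : {fset nat * nat * nat},
  \sum_(x <- B) `|summand q r u x| <= M.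
Proof.
have [M hM] := summand_bound.
have M0 : 0 <= M.
  by move: (hM 0 0 0)%N; rewrite !expr0 !mulr1; apply: le_trans.
exists (M * ((1 - `|r|)^-1 * ((1 - `|u|)^-1 * (2 * (1 - `|r|)^-1)))) => B.
pose n := (\max_(x <- B) maxn (maxn x.1.1 x.1.2) x.2).+1.
pose box := [seq (p, k) | p <- [seq (i, j) | i <- index_iota 0 n, j <- index_iota 0 n],
  k <- index_iota 0 n].
have hbox : {subset B <= box}.
  move=> [[i j] k] xB.
  have : (maxn (maxn i j) k < n)%N.
    rewrite ltnS; exact: (leq_bigmax_seq (P := xpredT)
      (F := fun x : nat * nat * nat => maxn (maxn x.1.1 x.1.2) x.2) _ xB).
  rewrite !gtn_max => /andP[/andP[hi hj] hk].
  by rewrite !allpairs_f // mem_index_iota.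
have ubox : uniq box.
  apply: allpairs_uniq; rewrite ?iota_uniq //; last by move=> [a b] [c d] _ _ [-> ->].
  by apply: allpairs_uniq; rewrite ?iota_uniq // => -[a b] [c d] _ _ [-> ->].
apply: le_trans (ler_sum_fset_seq _ ubox hbox) _; first by [].
rewrite !big_allpairs_dep /=.
(* The sum over j goes innermost: its centre depends on i and k, its bound does not. *)
apply: (@le_trans _ _ (\sum_(0 <= i < n) \sum_(0 <= k < n) \sum_(0 <= j < n)
   M * (`|r| ^+ i * (`|u| ^+ k
     * `|r| ^+ (((i + 3 * k)./2 - j) + (j - (i + 3 * k)./2)))))).
  apply: ler_sum => i _; rewrite exchange_big.
  by do 2!apply: ler_sum => ? _; exact: hM.
have g0 (t : C) : `|t| < 1 -> 0 <= (1 - `|t|)^-1.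
  by move=> t1; rewrite invr_ge0 subr_ge0 ltW.
apply: (@le_trans _ _ (\sum_(0 <= i < n) M * (`|r| ^+ i
    * ((1 - `|u|)^-1 * (2 * (1 - `|r|)^-1))))).
  apply: ler_sum => i _.
  under eq_bigr do rewrite -!mulr_sumr.
  rewrite -!mulr_sumr ler_wpM2l // ler_wpM2l ?exprn_ge0 //.
  apply: (@le_trans _ _ (\sum_(0 <= k < n) `|u| ^+ k * (2 * (1 - `|r|)^-1))).
    apply: ler_sum => k _; rewrite ler_wpM2l ?exprn_ge0 //.
    exact: sum_dist_geometric.
  by rewrite -mulr_suml ler_wpM2r ?mulr_ge0 ?g0 // geometric_sum_le.
rewrite -mulr_sumr ler_wpM2l // -mulr_suml ler_wpM2r ?mulr_ge0 ?g0 //.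
exact: geometric_sum_le.
Qed.

Definition theta_factor (a : nat) : C :=
  m1_half_pow R a%:Z * r ^+ (a * a) * qpochinf (q ^ (1 - a%:Z)) (q ^+ 2).

(** Here q^(1-a) = q^(-2b), so the factor of index b is 1 - 1 = 0; the induction strips the factors
    before it. *)
Lemma theta_factor_odd b : theta_factor b.*2.+1 = 0.
Proof.
suff h : qpochinf (q ^ (1 - b.*2.+1%:Z)) (q ^+ 2) = 0 by rewrite /theta_factor h mulr0.
elim: b => [|b IH]; rewrite qpochinfSl //.
  by rewrite (_ : 1 - 0.*2.+1%:Z = 0) // expr0z subrr mul0r.
have -> : q ^ (1 - b.+1.*2.+1%:Z) * q ^+ 2 = q ^ (1 - b.*2.+1%:Z).
  by rewrite -[q ^+ 2]/(q ^ 2%:Z) -expfzDr //; congr (_ ^ _); clear; lia.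
by rewrite IH mulr0.
Qed.

(** Each step strips a factor 1 - q^(-2b-1); the sign change of (-1)^(a/2) and r^(4(2b+1)) =
    q^(2b+1) turn it into 1 - q^(2b+1), the next factor of the finite product. *)
Lemma theta_factor_even b :
  theta_factor b.*2 = qpoch q (q ^+ 2) b * qpochinf q (q ^+ 2).
Proof.
rewrite /theta_factor; elim: b => [|b IH].
  by rewrite m1_half_pow0 expr0 subr0 qpoch0 expr1z !mul1r.
rewrite qpochS [RHS]mulrAC -IH qpochinfSl //.
have -> : q ^ (1 - b.+1.*2%:Z) * q ^+ 2 = q ^ (1 - b.*2%:Z).
  by rewrite -[q ^+ 2]/(q ^ 2%:Z) -expfzDr //; congr (_ ^ _); clear; lia.
rewrite (_ : b.+1.*2%:Z = b.*2%:Z + 2); last by clear; lia.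
rewrite m1_half_powD2 (_ : 1 - (b.*2%:Z + 2) = - b.*2.+1%:Z); last by clear; lia.
rewrite -exprnN (_ : b.+1.*2 * b.+1.*2 = b.*2 * b.*2 + 4 * b.*2.+1)%N; last by clear; lia.
rewrite exprD [r ^+ (4 * _)]exprM rq -exprM.
rewrite (_ : q * q ^+ (2 * b) = q ^+ b.*2.+1); last by rewrite -exprS mul2n.
have : q ^+ b.*2.+1 != 0 by rewrite expf_neq0.
move: (q ^+ b.*2.+1) => z z0.
by field.
Qed.

(** Since (a - 2j)^2/4 = a^2/4 + 2 C(j,2) + (1 - a) j, the dependence on j is that of the Euler
    series with base q^2 at q^(1-a). *)
Lemma tends_sum_j i k :
  tends (fun n => \sum_(0 <= j < n) summand q r u (i, j, k))
    (u ^+ (i + k) * q ^+ 'C(i, 2) / (qpoch q q i * qpoch (q ^+ 3) (q ^+ 3) k)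
     * theta_factor (i + 3 * k)).
Proof.
set a := (i + 3 * k)%N; rewrite /theta_factor !mulrA.
have h := tendsMl (u ^+ (i + k) * q ^+ 'C(i, 2)
  / (qpoch q q i * qpoch (q ^+ 3) (q ^+ 3) k) * m1_half_pow R a * r ^+ (a * a))
  (tends_euler (q ^ (1 - a%:Z)) q21).
apply: tends_eq h => n; rewrite mulr_sumr; apply: eq_bigr => j _.
rewrite /summand (_ : i%:Z - 2 * j%:Z + 3 * k%:Z = a%:Z - 2 * j%:Z); last first.
  by rewrite /a PoszD PoszM; ring.
rewrite m1_half_powB /euler_coef.
have -> : r ^ (2 * (i%:Z ^+ 2 - i%:Z) + (a%:Z - 2 * j%:Z) ^+ 2)
    = q ^+ 'C(i, 2) * r ^+ (a * a) * ((q ^+ 2) ^+ 'C(j, 2) * (q ^ (1 - a%:Z)) ^+ j).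
  have qE (x : int) : q ^ x = r ^ (4 * x) by rewrite -rq exprnP exprz_exp.
  rewrite -exprM !(exprnP q) (exprnP r) (exprnP (q ^ _)) !qE exprz_exp -!expfzDr //.
  congr (_ ^ _).
  have hb l : 2 * 'C(l, 2)%:Z = l%:Z * l%:Z - l%:Z.
    by rewrite -PoszM -bin2_sq PoszD addrK -mul2n PoszM.
  have := hb i; have := hb j; rewrite !PoszM.
  move: (i%:Z) (j%:Z) (a%:Z) ('C(i, 2)%:Z) ('C(j, 2)%:Z) => *; lra.
rewrite !invfM; ring.
Qed.

(** As a = (s - k) + 3k = s + 2k has the parity of s, odd antidiagonals vanish; for s = 2N, a/2 = N
    + k is the length of the product in [cubic_term]. *)
Lemma sum_antidiagonal s :
  \sum_(0 <= k < s.+1) u ^+ (s - k + k) * q ^+ 'C(s - k, 2)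
    / (qpoch q q (s - k) * qpoch (q ^+ 3) (q ^+ 3) k) * theta_factor (s - k + 3 * k)
  = if odd s then 0
    else qpochinf q (q ^+ 2) * (cubic_coef q s./2 * (u ^+ 2) ^+ s./2).
Proof.
case: ifP => os.
  rewrite big_nat big1 // => k /andP[_]; rewrite ltnS => ks.
  rewrite (_ : s - k + 3 * k = (s./2 + k).*2.+1)%N; first by rewrite theta_factor_odd mulr0.
  by move: (odd_double_half s); rewrite os; clear -ks; lia.
set N := s./2; have -> : s = N.*2 by rewrite -[LHS]odd_double_half os.
rewrite /cubic_coef mulr_suml mulr_sumr; apply: eq_big_nat => k /andP[_]; rewrite ltnS => ks.
rewrite (_ : N.*2 - k + 3 * k = (N + k).*2)%N; last by clear -ks; lia.
rewrite theta_factor_even subnK // /cubic_term -exprM mul2n; ring.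
Qed.

Lemma has_sum_summand : has_sum (summand q r u)
  (qpochinf q (q ^+ 2) * (qpochinf (- u ^+ 2) (q ^+ 3) / qpochinf (u ^+ 2) (q ^+ 6))).
Proof.
have [M hM] := norm_sums_bounded; apply: (has_sum_approx hM) => A e e0.
set L := _ * _; pose c i k := u ^+ (i + k) * q ^+ 'C(i, 2)
  / (qpoch q q i * qpoch (q ^+ 3) (q ^+ 3) k) * theta_factor (i + 3 * k).
have e20 : 0 < e / 2 by rewrite divr_gt0.
have w1 : `|u ^+ 2| < 1 by rewrite normrX exprn_ilt1.
have sE n : \sum_(0 <= s < n.*2) \sum_(0 <= k < s.+1) c (s - k)%N k
    = qpochinf q (q ^+ 2) * \sum_(0 <= N < n) cubic_coef q N * (u ^+ 2) ^+ N.
  elim: n => [|n IH]; first by rewrite !big_nil mulr0.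
  rewrite doubleS big_nat_recr //= big_nat_recr //= IH !sum_antidiagonal /=.
  by rewrite odd_double /= doubleK addr0 big_nat_recr //= mulrDr.
have /tendsP/(_ _ e20)[N0 hN0] := tendsMl (qpochinf q (q ^+ 2)) (tends_cubic_series q0 q1 w1).
pose m := \max_(x <- A) maxn (x.1.1 + x.2) x.1.2.
have hm i j k : (i, j, k) \in A -> (i + k <= m)%N && (j <= m)%N.
  move=> xA; rewrite -geq_max.
  exact: (leq_bigmax_seq (P := xpredT)
    (F := fun x : nat * nat * nat => maxn (x.1.1 + x.2) x.1.2) _ xA).
(* First n is fixed, for the series in u^2 and to cover A; only then J, for the finitely many sums
   over j with i + k < 2n. *)
pose n := maxn N0 m.+1.
have /tendsP/(_ _ e20)[J0 hJ0] : tends (fun J => \sum_(x <- triangle n.*2 J) summand q r u x)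
    (\sum_(0 <= s < n.*2) \sum_(0 <= k < s.+1) c (s - k)%N k).
  apply: tends_eq (tends_sum _ (fun s => tends_sum _ (fun k => tends_sum_j (s - k) k))) => J.
  by rewrite /triangle !big_allpairs_dep.
pose J := maxn J0 m.+1.
exists [fset x in triangle n.*2 J]%fset.
  apply/fsubsetP => -[[i j] k] /hm /andP[h1 h2].
  rewrite !inE /= mem_triangle; apply/andP; rewrite /n /J; clear -h1 h2; lia.
have -> : \sum_(x <- [fset x in triangle n.*2 J]%fset) summand q r u x
    = \sum_(x <- triangle n.*2 J) summand q r u x.
  apply: perm_big; apply: uniq_perm; rewrite ?fset_uniq ?uniq_triangle //.
  by move=> x; rewrite !inE.
have h1 := hJ0 J (leq_maxl _ _); have h2 := hN0 n (leq_maxl _ _).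
rewrite -/L -sE in h2.
rewrite distrC (splitr e); apply: le_lt_trans (ltrD h2 h1).
by apply: le_trans (ler_normD _ _); rewrite addrA subrK.
Qed.
End Assembly.

Theorem theorem4p8 (R : realType) (q r u : R[i])
    (hq0 : 0 < `|q|) (hq1 : `|q| < 1) (hr : r ^+ 4 = q) (hu : `|u| < 1) :
  has_sum (summand q r u)
    (qpochinf q (q ^+ 2) * qpochinf (- u ^+ 2) (q ^+ 3)
     / qpochinf (u ^+ 2) (q ^+ 6)).
Proof. by rewrite -mulrA; exact: has_sum_summand. Qed.
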